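(* Let $\mathcal{M}=(S,\mathbf{P},s_0,E,g)$ be an event model and let $\mathcal{B}=(Y,h)$ be an observation model for $\mathcal{M}$. Let $\mathcal{D}=(Q,E,\delta,q_0,F)$ and $\mathcal{D}'=(Q',E,\delta',q_0',F')$ be two deterministic finite automata over the alphabet $E$ such that $L(\mathcal{D})=L(\mathcal{D}')$, where $L(\cdot)$ denotes the language accepted by an automaton. Let $\mathcal{P}=\mathcal{P}_{(\mathcal{M},\mathcal{B};\mathcal{D})}$ and $\mathcal{P}'=\mathcal{P}_{(\mathcal{M},\mathcal{B};\mathcal{D}')}$ be the associated Goal POMDPs, with initial belief states $b_0$ and $b_0'$ respectively. Let $V^*_{\mathcal{P}}(b_0)$ and $V^*_{\mathcal{P}'}(b_0')$ denote the optimal expected costs of reaching a goal belief state from the initial belief state in $\mathcal{P}$ and in $\mathcal{P}'$, respectively. Then $$V^*_{\mathcal{P}}(b_0)=V^*_{\mathcal{P}'}(b_0').$$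
   Context: For a finite set $X$, $\Delta(X)$ denotes the set of probability distributions on $X$. **Event model.** A tuple $\mathcal{M}=(S,\mathbf{P},s_0,E,g)$ where $S$ is a nonempty finite set of states; $\mathbf{P}:S\times S\to[0,1]$ satisfies $\sum_{s'\in S}\mathbf{P}(s,s')=1$ for every $s\in S$; $s_0\in S$ is the initial state; $E$ is a finite set of events; and $g:S\to 2^E$ assigns to each state the set of events occurring at that state, with $g(s_0)=\emptyset$. **Observation model.** For an event model $\mathcal{M}$, a pair $\mathcal{B}=(Y,h)$ where $Y$ is a set of observations and $h:S\times Y\to[0,1]$ satisfies $\sum_{y\in Y}h(s,y)=1$ for every $s\in S$. **DFA.** $\mathcal{D}=(Q,E,\delta,q_0,F)$ with finite state set $Q$, alphabet $E$, (total) transition function $\delta:Q\times E\to Q$, initial state $q_0$, and set of accepting states $F\subseteq Q$. **Goal POMDP.** Given an event model $\mathcal{M}=(S,\mathbf{P},s_0,E,g)$, an observation model $\mathcal{B}=(Y,h)$ for $\mathcal{M}$, and a DFA $\mathcal{D}=(Q,E,\delta,q_0,F)$ whose alphabet is the event set $E$ of $\mathcal{M}$, the associated Goal POMDP is $\mathcal{P}_{(\mathcal{M},\mathcal{B};\mathcal{D})}=(X,A,b_0,\mathbf{T},X_G,Z,\mathbf{O},c)$, where: - $X=S\times Q$ is the state space and $A=E$ is the action space; - $b_0\in\Delta(X)$ is the point mass at $(s_0,q_0)$; - $\mathbf{T}:X\times A\times X\to[0,1]$ is given by: $\mathbf{T}((s,q),e,(s',q'))=\mathbf{P}(s,s')$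 if $q\notin F$, $q'=\delta(q,e)$ and $e\in g(s')$; $=\mathbf{P}(s,s')$ if $q\notin F$, $q'=q$ and $e\notin g(s')$; $=1$ if $q\in F$, $q'=q$ and $s'=s$; and $=0$ otherwise; - $X_G=S\times F$ is the set of goal states; - $Z=(\{\mathrm{True},\mathrm{False}\}\times Y)\cup\{\bot\}$ is the set of observations; - $\mathbf{O}:A\times X\times Z\to[0,1]$ is given, for $e\in E$, $(s,q)\in X$, $y\in Y$, by: if $q\notin F$ and $e\in g(s)$, then $\mathbf{O}(e,(s,q),(\mathrm{True},y))=h(s,y)$ and $\mathbf{O}(e,(s,q),(\mathrm{False},y))=0$; if $q\notin F$ and $e\notin g(s)$, then $\mathbf{O}(e,(s,q),(\mathrm{False},y))=h(s,y)$ and $\mathbf{O}(e,(s,q),(\mathrm{True},y))=0$; if $q\notin F$, then $\mathbf{O}(e,(s,q),\bot)=0$; if $q\in F$, then $\mathbf{O}(e,(s,q),\bot)=1$ and $\mathbf{O}(e,(s,q),z)=0$ for every $z\ne\bot$; - $c:X\times A\to\mathbb{R}_{\ge0}$ is given by $c(x,a)=1$ if $x\notin X_G$ and $c(x,a)=0$ if $x\in X_G$. **Belief MDP and optimal expected cost.** For $b\in\Delta(X)$, $a\in A$, $z\in Z$, let $$\Pr(z\mid a,b)=\sum_{x\in X}\mathbf{O}(a,x,z)\sum_{x'\in X}\mathbf{T}(x',a,x)\,b(x'),$$ and, when $\Pr(z\mid a,b)>0$, let $b_z^a\in\Delta(X)$ be the updated belief $$b_z^a(x)=\frac{\mathbf{O}(a,x,z)\sum_{x'\in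 X}\mathbf{T}(x',a,x)\,b(x')}{\Pr(z\mid a,b)}.$$ The belief MDP has state space $\Delta(X)$ and action set $A$. Under action $a$ the belief $b$ moves to $b_z^a$ with probability $\Pr(z\mid a,b)$, at cost $c'(b,a)=\sum_{x\in X}b(x)c(x,a)$. A goal belief state is a belief supported on $X_G$. A policy is a function $\pi:\Delta(X)\to A$. Starting from $b_0$ and following $\pi$ gives a random sequence of beliefs $b_0,b_1,b_2,\dots$, and the expected cost of $\pi$ is $\mathbb{E}\big[\sum_{k\ge0}c'(b_k,\pi(b_k))\big]\in[0,\infty]$. Equivalently, this is the expected number of steps until a goal belief state is reached. The optimal expected cost $V^*_{\mathcal{P}}(b_0)\in[0,\infty]$ is the infimum of the expected cost over all policies. It corresponds to the Bellman recurrence $V^*(b)=\min_{a\in A}\big(c'(b,a)+\sum_{z\in Z}\Pr(z\mid a,b)V^*(b_z^a)\big)$. *)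

(* Defs.v *)
From HB Require Import structures.
From mathcomp Require Import all_boot all_order all_algebra.
From mathcomp Require Import all_classical all_reals all_analysis.

Set Implicit Arguments.
Unset Strict Implicit.
Unset Printing Implicit Defensive.

Import Order.TTheory GRing.Theory Num.Theory.

Local Open Scope ring_scope.

(* The set Delta(X).  Being a finite function with a boolean side condition, a
   distribution is determined by its values. *)
Record dist (R : realType) (X : finType) := Dist {
  dist_fun :> {ffun X -> R};
  distP : [forall x, 0 <= dist_fun x] && (\sum_x dist_fun x == 1)
}.

Lemma point_mass_subproof (R : realType) (X : finType) (x0 : X) :
  let f := [ffun x : X => (x == x0)%:R : R] in
  [forall x, 0 <= f x] && (\sum_x f x == 1).
Proof.
apply/andP; split; first by apply/forallP => x; rewrite ffunE ler0n.
rewrite (bigD1 x0)//= ffunE eqxx big1 ?addr0// => x /negbTE xx0.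
by rewrite ffunE xx0.
Qed.

Definition point_mass (R : realType) (X : finType) (x0 : X) : dist R X :=
  Dist (point_mass_subproof R x0).

Record event_model (R : realType) (S E : finType) := EventModel {
  em_P : S -> S -> R;
  em_P01 : forall s s', 0 <= em_P s s' <= 1;
  em_P_sum : forall s, \sum_(s' : S) em_P s s' = 1;
  em_init : S;
  em_ev : S -> {set E};
  em_ev_init : em_ev em_init = finset.set0
}.

(* [Y] is an arbitrary, possibly infinite, set; the choice structure is what
   unordered summation over [Y] requires, and every set has one classically. *)
Record obs_model (R : realType) (S : finType) (Y : choiceType) := ObsModel {
  om_h : S -> Y -> R;
  om_h01 : forall s y, 0 <= om_h s y <= 1;
  om_h_sum : forall s, (\esum_(y in [set: Y]) (om_h s y)%:E = 1)%E
}.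

Record dfa (E Q : finType) := DFA {
  dfa_delta : Q -> E -> Q;
  dfa_init : Q;
  dfa_acc : {set Q}
}.

Definition dfa_lang (E Q : finType) (D : dfa E Q) : set (seq E) :=
  [set w | foldl (dfa_delta D) (dfa_init D) w \in dfa_acc D]%classic.

Record pomdp (R : realType) (X A : finType) (Z : choiceType) := POMDP {
  po_b0 : dist R X;
  po_T : X -> A -> X -> R;
  po_goal : {set X};
  po_O : A -> X -> Z -> R;
  po_cost : X -> A -> R
}.

Section GoalPOMDP.
Context (R : realType) (S E Q : finType) (Y : choiceType).
Variables (M : event_model R S E) (B : obs_model R S Y) (D : dfa E Q).

Definition goal_T (x : S * Q) (e : E) (x' : S * Q) : R :=
  let: (s, q) := x in let: (s', q') := x' in
  if q \in dfa_acc D then ((q' == q) && (s' == s))%:R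
  else if (q' == dfa_delta D q e) && (e \in em_ev M s')
          || (q' == q) && (e \notin em_ev M s')
       then em_P M s s'
       else 0.

Definition goal_set : {set S * Q} :=
  finset.finset (fun x : S * Q => x.2 \in dfa_acc D).

(* [None] is the observation bottom; [Some (b, y)] is the pair (b, y). *)
Definition goal_O (e : E) (x : S * Q) (z : option (bool * Y)) : R :=
  let: (s, q) := x in
  if q \in dfa_acc D then (if z is None then 1 else 0)
  else if z is Some (b, y) then
         (if b == (e \in em_ev M s) then om_h B s y else 0)
       else 0.

Definition goal_cost (x : S * Q) (e : E) : R := (x \notin goal_set)%:R.

Definition goal_pomdp : pomdp R (S * Q)%type E (option (bool * Y)%type) :=
  POMDP (point_mass R (em_init M, dfa_init D)) goal_T goal_set goal_O goal_cost.

End GoalPOMDP.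

Section BeliefMDP.
Context (R : realType) (X A : finType) (Z : choiceType).
Variable P : pomdp R X A Z.

Definition obs_prob (b : dist R X) (a : A) (z : Z) : R :=
  \sum_(x : X) po_O P a x z * \sum_(x' : X) po_T P x' a x * b x'.

Definition belief_update (b : dist R X) (a : A) (z : Z) (x : X) : R :=
  po_O P a x z * (\sum_(x' : X) po_T P x' a x * b x') / obs_prob b a z.

(* Probability that [b] moves to [b'] under [a]: distinct observations may lead
   to the same updated belief, so their probabilities add up. *)
Definition belief_trans (b : dist R X) (a : A) (b' : dist R X) : \bar R :=
  (\esum_(z in [set z : Z | (0 < obs_prob b a z)%R /\
                        forall x, b' x = belief_update b a z x]%classic)
     (obs_prob b a z)%:E)%E.

Definition belief_cost (b : dist R X) (a : A) : R :=
  \sum_(x : X) b x * po_cost P x a.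

Definition policy := dist R X -> A.

(* [b] is a random sequence of beliefs, started at [po_b0 P], that follows
   [pi].  As policies are arbitrary functions of the belief, beliefs carry the
   discrete sigma-algebra; every step of the chain has countable support, so
   the probabilities of finite paths determine its law. *)
Definition belief_process (pi : policy) (d : measure_display)
    (W : measurableType d) (mu : probability W R) (b : nat -> W -> dist R X) :=
  [/\ forall n (B : set (dist R X)), measurable (b n @^-1` B)%classic,
      mu [set w | b 0%N w = po_b0 P]%classic = 1%E &
      forall n (path : nat -> dist R X),
        mu [set w | forall k, (k <= n.+1)%N -> b k w = path k]%classic =
        (mu [set w | forall k, (k <= n)%N -> b k w = path k]%classic *
         belief_trans (path n) (pi (path n)) (path n.+1))%E].

Definition expected_cost (pi : policy) (v : \bar R) : Prop :=
  exists (d : measure_display) (W : measurableType d) (mu : probability W R)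
         (b : nat -> W -> dist R X),
    belief_process pi mu b /\
    v = (\int[mu]_w \sum_(0 <= k <oo)
           (belief_cost (b k w) (pi (b k w)))%:E)%E.

Definition optimal_cost : \bar R :=
  ereal_inf [set v | exists pi : policy, expected_cost pi v]%classic.

End BeliefMDP.

(* Main.v *)
(* Along every reachable belief the automaton state is known, because the agent
   observes whether each requested event was captured; so a reachable belief is
   a distribution on [S] paired with one state of the automaton.  Pairing beliefs
   that have the same [S]-part and automaton states with the same residual
   language gives a bisimulation of the two belief MDPs, under which the n-stage
   optimal values agree.

   It remains to see that the optimal cost is the supremum of the n-stage optimal
   values.  Every belief process following a policy has expected cost equal to
   the supremum of the n-stage costs of that policy, since its path law determines
   the expected n-stage cost; hence the lower bound.  As there are finitely many
   actions, some action at each belief is greedy for the limit value function, and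
   the stationary greedy policy costs at most the limit value.  A process following
   it exists: its successive steps are read off a uniform random variable on
   [0, 1[ by cutting the interval into cells of lengths the transition
   probabilities and rescaling the chosen cell to [0, 1[. *)
Require Import Defs.
From mathcomp Require Import all_boot all_order all_algebra.
From mathcomp Require Import finmap.
From mathcomp Require Import all_classical all_reals all_analysis measurable_realfun.

Set Implicit Arguments.
Unset Strict Implicit.
Unset Printing Implicit Defensive.

Import Order.TTheory GRing.Theory Num.Theory.

Local Open Scope classical_set_scope.
Local Open Scope ring_scope.

(** * Probability mass functions on arbitrary sets *)

Section CountablePmf.
Context (R : realType) (Z : choiceType) (p : Z -> R).
Hypothesis p0 : forall z, 0 <= p z.
Hypothesis p1 : (\esum_(z in [set: Z]) (p z)%:E = 1)%E.

(** The support is the union of the sets where [p] is at least [1/(n+1)]; each is finite, since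
    [n+2] such points would have total mass above 1. *)
Lemma pmf_support_countable : countable [set z | 0 < p z].
Proof.
have -> : [set z | 0 < p z] = \bigcup_(n : nat) [set z | n.+1%:R^-1 <= p z].
  apply/seteqP; split => z /=; last first.
    by case=> n _ /=; apply: lt_le_trans; rewrite invr_gt0.
  move=> pz; have [n nz] : exists n : nat, (p z)^-1 <= n.+1%:R.
    exists (Num.truncn (p z)^-1); exact: (ltW (truncnS_gt _)).
  by exists n => //=; rewrite -[leRHS]invrK lef_pV2// posrE// invr_gt0.
apply: bigcup_countable => // n _; apply: finite_set_countable.
apply: contrapT => /(infinite_set_fset n.+2)[X XA cX].
have : (\sum_(z \in [set` X]) (p z)%:E <= 1)%E.
  by rewrite -p1; apply: ereal_sup_ubound; exists [set` X].
rewrite fsbig_finite//= set_fsetK sumEFin lee_fin => X1.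
have : \sum_(z <- X) (n.+1%:R^-1 : R) <= 1.
  by apply: le_trans X1; rewrite !big_seq; apply: ler_sum => z /XA.
rewrite big_const_seq count_predT iter_addr_0.
rewrite -[leLHS]mulr_natl ler_pdivrMr ?ltr0n// mul1r ler_nat leqNgt => /negP; apply.
exact: leq_trans cX.
Qed.

(** Replaces unordered sums over [Z] by series, to which counting-measure integration applies. The
    enumeration is chosen before [f], so one serves all integrands. *)
Lemma pmf_enum : exists (e : nat -> Z) (q : nat -> R), (forall j, 0 <= q j) /\
  forall f : Z -> \bar R, (forall z, 0 <= f z)%E ->
    (\esum_(z in [set: Z]) (p z)%:E * f z = \sum_(j <oo) (q j)%:E * f (e j))%E.
Proof.
have /countable_injP[i i_inj] := pmf_support_countable.
pose Zp := [set z | 0 < p z].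
(* [z0] is the value of [e] at indices outside the image of [i]; these get weight 0. *)
have [z0 _] : exists z, Zp z.
  apply: contrapT => /forallNP Z0.
  suff : (\esum_(z in [set: Z]) (p z)%:E = 0)%E.
    by rewrite p1 => /eqP; rewrite onee_eq0.
  apply: esum1 => z _; congr EFin; apply/eqP; rewrite eq_le p0 andbT leNgt.
  exact/negP/Z0.
pose e j := xget z0 [set z | Zp z /\ i z = j].
have ei z : Zp z -> e (i z) = z.
  move=> pz; rewrite /e; case: xgetP => [y _ [py iy]|/(_ z)[]//].
  by apply: i_inj; rewrite ?inE.
exists e, (fun j => if j \in i @` Zp then p (e j) else 0); split.
  by move=> j; case: ifP.
move=> f f0.
rewrite nneseries_esumT; last first.
  by move=> j; apply: mule_ge0 => //; rewrite lee_fin; case: ifP.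
transitivity (\esum_(z in Zp) (p z)%:E * f z)%E.
  rewrite [RHS]esum_mkcond; apply: eq_esum => z _; case: ifPn => //.
  rewrite notin_setE /Zp/= => /negP; rewrite -leNgt => pz.
  by rewrite (_ : p z = 0) ?mul0e//; apply/eqP; rewrite eq_le pz p0.
transitivity (\esum_(j in i @` Zp) (p (e j))%:E * f (e j))%E.
  rewrite esum_image; first by apply: eq_esum => z /ei ->.
  by move=> x y; exact: i_inj.
by rewrite esum_mkcond; apply: eq_esum => j _; case: ifP => //; rewrite mul0e.
Qed.

End CountablePmf.

(** * Countable Markov chains: expected cost *)

Lemma ge0_nneseriesZl (R : realType) (x : \bar R) (f : nat -> \bar R) :
  (0 <= x)%E -> (forall j, 0 <= f j)%E ->
  (\sum_(j <oo) x * f j = x * \sum_(j <oo) f j)%E.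
Proof.
move=> x0 f0; rewrite -[LHS]ge0_integral_count; last first.
  by move=> j; exact: mule_ge0.
by rewrite ge0_integralZl// ge0_integral_count.
Qed.

Lemma nneseries_only (R : realType) (k : nat) (f : nat -> \bar R) :
  (0 <= f k)%E -> (forall j, j <> k -> f j = 0)%E -> (\sum_(j <oo) f j = f k)%E.
Proof.
move=> f0 fk; rewrite nneseries_esumT; last first.
  by move=> j; have [->//|/eqP/fk ->] := eqVneq j k.
rewrite -[RHS](@esum_set1 R nat k f)// [RHS]esum_mkcond; apply: eq_esum => j _.
by case: ifPn => //; rewrite notin_setE => /= /fk.
Qed.

Section Chain.
Context (R : realType) (T : Type) (p : T -> nat -> R) (nx : T -> nat -> T).
Hypothesis p0 : forall x j, 0 <= p x j.
Hypothesis p1 : forall x, (\sum_(j <oo) (p x j)%:E = 1)%E.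

Local Open Scope ereal_scope.

Definition step_mean (f : T -> \bar R) (x : T) : \bar R :=
  \sum_(j <oo) (p x j)%:E * f (nx x j).

(** Written as the mean of an indicator, so that all indices leading to [y] contribute. *)
Definition step_to (x y : T) : \bar R :=
  step_mean (fun z => (`[< z = y >]%:R)%:E) x.

Fixpoint mean_cost (c : T -> R) (n : nat) (x : T) : \bar R :=
  if n is m.+1 then (c x)%:E + step_mean (mean_cost c m) x else 0.

Definition chain_law d (W : measurableType d) (mu : probability W R)
    (b : nat -> W -> T) :=
  (forall n (B : set T), measurable (b n @^-1` B)) /\
  forall n (path : nat -> T),
    mu [set w | forall k, (k <= n.+1)%N -> b k w = path k] =
    mu [set w | forall k, (k <= n)%N -> b k w = path k] *
    step_to (path n) (path n.+1).

Lemma step_mean_ge0 f x : (forall y, 0 <= f y) -> 0 <= step_mean f x.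
Proof. by move=> f0; apply: nneseries_ge0 => j _ _; rewrite mule_ge0 ?lee_fin. Qed.

Lemma step_to_ge0 x y : 0 <= step_to x y.
Proof. by apply: step_mean_ge0 => z; rewrite lee_fin. Qed.

Lemma mean_cost_ge0 c n x : (forall y, 0 <= c y)%R -> 0 <= mean_cost c n x.
Proof.
move=> c0; elim: n x => //= n IH x.
by rewrite adde_ge0 ?lee_fin ?step_mean_ge0.
Qed.

(* [nx x] need not be injective: a state reached along several indices is
   counted at the first of them. *)
Lemma step_meanE f x : (forall y, 0 <= f y) ->
  step_mean f x = \sum_(j <oo)
    if `[< forall i, (i < j)%N -> nx x i <> nx x j >]
    then step_to x (nx x j) * f (nx x j) else 0.
Proof.
move=> f0.
pose first j := `[< forall i, (i < j)%N -> nx x i <> nx x j >].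
pose a i j : \bar R := if first j && `[< nx x i = nx x j >]
                       then (p x i)%:E * f (nx x i) else 0.
have a0 i j : 0 <= a i j by rewrite /a; case: ifP; rewrite ?mule_ge0 ?lee_fin.
(* Each index [i] is charged to a single [j], the first index with the same successor; interchanging
   the series then groups the mass by successor. *)
transitivity (\sum_(i <oo) \sum_(j <oo) a i j).
  apply: eq_eseriesr => i _.
  have ex : exists j, `[< nx x i = nx x j >] by exists i; apply/asboolP.
  case: (ex_minnP ex) => k /asboolP ik kmin.
  rewrite (nneseries_only (k := k))//.
    rewrite /a ifT//; apply/andP; split; last exact/asboolP.
    apply/asboolP => j jk kj; have := kmin j; rewrite leqNgt jk => /(_ _)/negP.
    by apply => //; apply/asboolP; rewrite ik kj.
  move=> j jk; rewrite /a; case: ifP => // /andP[/asboolP fj /asboolP ij].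
  have kj : (k <= j)%N by apply: kmin; apply/asboolP.
  case: (@fj k); last by rewrite -ik.
  by rewrite ltn_neqAle kj andbT; apply/eqP => kj'; exact: jk.
rewrite nneseries_interchange//; apply: eq_eseriesr => j _.
rewrite /a -/(first j); case: (first j) => /=; last by rewrite eseries0.
rewrite muleC -ge0_nneseriesZl//; last by move=> i; rewrite mule_ge0 ?lee_fin.
apply: eq_eseriesr => i _; case: asboolP => [<-|_]; last by rewrite !mule0.
by rewrite mule1 muleC.
Qed.

Section Cost.
Context (c : T -> R) (c0 : forall x, (0 <= c x)%R).
Context d (W : measurableType d) (mu : probability W R) (b : nat -> W -> T).
Hypothesis b_chain : chain_law mu b.

Let A m (path : nat -> T) := [set w | forall k, (k <= m)%N -> b k w = path k].

Lemma measurable_chain_path m path : measurable (A m path).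
Proof.
rewrite (_ : A m path = \bigcap_(k < m.+1) (b k @^-1` [set path k])).
  by apply: bigcap_measurableType => k _; exact: b_chain.1.
by apply/seteqP; split => w /= h k; apply: h.
Qed.

(** No measurability of [f] is asked: every preimage under [b n] is measurable. *)
Lemma measurable_chain_fun n (f : T -> \bar R) (D : set W) :
  measurable_fun D ((fun w => f (b n w)) : W -> \bar R).
Proof.
apply: measurable_funTS => _ Y mY; rewrite setTI.
exact: (b_chain.1 n (f @^-1` Y)).
Qed.

Lemma measurable_chain_cost (D : set W) m n :
  measurable_fun D ((fun w => \sum_(m <= k < n) (c (b k w))%:E) : W -> \bar R).
Proof.
by apply: emeasurable_sum => k; exact: (measurable_chain_fun k (EFin \o c)).
Qed.

(** Localizing to a fixed initial path lets the path law act as a Markov property. The event is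
    split, up to a null set, into countably many events according to the next state, and the
    induction hypothesis applies to each. *)
Lemma integral_chain_cost n m path :
  \int[mu]_(w in A m path) \sum_(m <= k < m + n) (c (b k w))%:E =
  mu (A m path) * mean_cost c n (path m).
Proof.
elim: n m path => [|n IH] m path /=.
  by rewrite addn0 mule0; apply: integral0_eq => w _; rewrite big_geq.
have mA := measurable_chain_path.
set x := path m.
transitivity (\int[mu]_(w in A m path)
    ((c x)%:E + \sum_(m.+1 <= k < m.+1 + n) (c (b k w))%:E)).
  apply: eq_integral => w; rewrite inE => Aw.
  by rewrite addSnnS big_ltn ?addnS ?ltnS ?leq_addr// Aw.
rewrite ge0_integralD//; last 3 first.
- by move=> w _; rewrite lee_fin.
- by move=> w _; apply: sume_ge0 => k _; rewrite lee_fin.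
- exact: measurable_chain_cost.
rewrite integral_cst// ge0_muleDr ?lee_fin//; last first.
  by apply: step_mean_ge0 => y; exact: mean_cost_ge0.
congr (_ + _); first by rewrite muleC.
(* [ext y] continues the path with [y] at time [m.+1]. Only first indices give nonempty pieces
   [F j], which makes the pieces disjoint. *)
pose ext y := fun k => if k == m.+1 then y else path k.
pose first j := `[< forall i, (i < j)%N -> nx x i <> nx x j >].
pose F j := if first j then A m.+1 (ext (nx x j)) else set0.
have extE y : A m.+1 (ext y) = A m path `&` b m.+1 @^-1` [set y].
  apply/seteqP; split => w /=.
    move=> h; split; last by have := h m.+1 (leqnn _); rewrite /ext eqxx.
    by move=> k km; rewrite h ?leqW// /ext ltn_eqF.
  case=> h wy k; rewrite /ext leq_eqVlt ltnS; case: eqP => [->//|_] /=.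
  exact: h.
have muext y : mu (A m.+1 (ext y)) = mu (A m path) * step_to x y.
  rewrite b_chain.2 /ext eqxx ltn_eqF//; congr (mu _ * _).
  apply/seteqP; split => w /= h k km; rewrite h//.
    by rewrite ltn_eqF.
  by rewrite ltn_eqF.
have mF j : measurable (F j) by rewrite /F; case: ifP.
have FA j : F j `<=` A m path.
  by rewrite /F; case: ifP => _; rewrite ?extE; [exact: subIsetl|exact: sub0set].
have tF : trivIset setT F.
  apply/trivIsetP => i j _ _; wlog ij : i j / (i < j)%N.
    move=> h; rewrite neq_ltn => /orP[] ij.
      by apply: h; rewrite ?neq_ltn ?ij.
    by rewrite setIC; apply: h; rewrite ?neq_ltn ?ij.
  move=> _; apply/seteqP; split => // w; rewrite /F.
  case: ifP => _; case: ifP => fj; rewrite ?setI0 ?set0I// !extE.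
  move/asboolP: fj => fj /= -[[_ wi] [_ wj]].
  by apply: (fj i ij); rewrite -wi -wj.
have sum_F f : (forall y, 0 <= f y) ->
    \sum_(j <oo) mu (F j) * f (nx x j) = mu (A m path) * step_mean f x.
  move=> f0; rewrite step_meanE// -ge0_nneseriesZl//; last first.
    by move=> j; case: ifP => // _; rewrite mule_ge0// step_to_ge0.
  apply: eq_eseriesr => j _; rewrite /F -/(first j).
  by case: (first j); rewrite ?measure0 ?mul0e ?mule0// muext muleA.
(* The weights [p x] sum to 1, so [sum_F] at the constant function 1 shows that the pieces exhaust
   the measure of [A m path]. *)
have muF : mu (A m path `\` \bigcup_j F j) = 0.
  transitivity (mu (A m path) - mu (\bigcup_j F j)).
    rewrite -[in RHS](setIidr (bigcup_sub (fun j _ => FA j))).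
    apply: measureD => //; first exact: bigcup_measurable.
    by rewrite (le_lt_trans (probability_le1 _ _))// ltry.
  have -> : mu (\bigcup_j F j) = \sum_(j <oo) mu (F j) * 1.
    under eq_eseriesr do rewrite mule1.
    by apply: measure_semi_bigcup => //; exact: bigcup_measurable.
  rewrite (sum_F (fun=> 1)) ?lee_fin//.
  rewrite /step_mean; under eq_eseriesr do rewrite mule1.
  by rewrite p1 mule1 subee// fin_num_measure.
have mU : measurable (A m path `\` \bigcup_j F j).
  by apply: measurableD => //; exact: bigcup_measurable.
rewrite (ge0_negligible_integral mU _ _ _ muF)//; last 2 first.
- exact: measurable_chain_cost.
- by move=> w _; apply: sume_ge0 => k _; rewrite lee_fin.
rewrite setDD setIidr; last exact: bigcup_sub.
rewrite ge0_integral_bigcup//; last 2 first.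
- exact: measurable_chain_cost.
- by move=> w _; apply: sume_ge0 => k _; rewrite lee_fin.
rewrite -sum_F; last by move=> y; exact: mean_cost_ge0.
apply: eq_eseriesr => j _; rewrite /F; case: ifP => _.
  by rewrite IH /ext eqxx.
by rewrite integral_set0 measure0 mul0e.
Qed.

Lemma chain_mean_cost x0 n : mu [set w | b 0%N w = x0] = 1 ->
  \int[mu]_w \sum_(0 <= k < n) (c (b k w))%:E = mean_cost c n x0.
Proof.
move=> init.
have A0 : [set w | b 0%N w = x0] = A 0%N (fun=> x0).
  apply/seteqP; split => w /=; first by move=> wx k; rewrite leqn0 => /eqP ->.
  exact.
have := integral_chain_cost n 0 (fun=> x0).
rewrite -A0 init mul1e add0n => <-.
have mA : measurable [set w | b 0%N w = x0] by exact: (b_chain.1 0%N [set x0]).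
rewrite (@ge0_negligible_integral _ _ _ mu setT (~` [set w | b 0%N w = x0]))//.
- by rewrite setTD setCK.
- exact: measurableC.
- exact: measurable_chain_cost.
- by move=> w _; apply: sume_ge0 => k _; rewrite lee_fin.
- transitivity (1 - mu [set w | b 0%N w = x0]); last by rewrite init subee.
  exact: probability_setC.
Qed.

(** Monotone convergence. The right-hand side involves neither [mu] nor [b], so all chains with the
    same transitions and start have the same expected cost. *)
Lemma chain_total_cost x0 : mu [set w | b 0%N w = x0] = 1 ->
  \int[mu]_w \sum_(k <oo) (c (b k w))%:E =
  ereal_sup (range (fun n => mean_cost c n x0)).
Proof.
move=> init; rewrite monotone_convergence//; last 3 first.
- by move=> n; exact: measurable_chain_cost.
- by move=> n w _; apply: sume_ge0 => k _; rewrite lee_fin.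
- move=> w _ i j ij; apply: ereal_nondecreasing_series => // k _ _.
  by rewrite lee_fin.
under eq_fun do rewrite (chain_mean_cost _ init).
apply/cvg_lim => //; apply: ereal_nondecreasing_cvgn => i j ij.
rewrite -!(chain_mean_cost _ init); apply: ge0_le_integral => //.
- by move=> w _; apply: sume_ge0 => k _; rewrite lee_fin.
- exact: measurable_chain_cost.
- exact: measurable_chain_cost.
- move=> w _; apply: ereal_nondecreasing_series => // k _ _.
  by rewrite lee_fin.
Qed.

End Cost.
End Chain.

(** * Countable Markov chains: existence *)

Section ChainExistence.
Context (R : realType) (T : Type) (p : T -> nat -> R) (nx : T -> nat -> T).
Hypothesis p0 : forall x j, 0 <= p x j.
Hypothesis p1 : forall x, (\sum_(j <oo) (p x j)%:E = 1)%E.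

Let cdf x j : R := \sum_(i < j) p x i.

Let cdfS x j : cdf x j.+1 = cdf x j + p x j.
Proof. by rewrite /cdf big_ord_recr. Qed.

Let cdf_homo x i j : (i <= j)%N -> cdf x i <= cdf x j.
Proof.
elim: j => [|j IH]; first by rewrite leqn0 => /eqP ->.
rewrite leq_eqVlt => /predU1P[->//|/IH /le_trans]; apply.
by rewrite cdfS lerDl.
Qed.

Let cdf_ge0 x j : 0 <= cdf x j.
Proof. by apply: sumr_ge0. Qed.

Let cdf_le1 x j : cdf x j <= 1.
Proof.
rewrite -lee_fin -(p1 x) /cdf -sumEFin -(big_mkord predT (fun i => (p x i)%:E)).
by apply: nneseries_lim_ge => i _ _; rewrite lee_fin.
Qed.

(* For fixed [x], the cells partition [0, 1[, the [j]-th having length [p x j]. *)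
Let cell x j u := cdf x j <= u < cdf x j.+1.

Let cell_inj x i j u : cell x i u -> cell x j u -> i = j.
Proof.
wlog ij : i j / (i < j)%N => [wl iu ju|].
  by case: (ltngtP i j) => // ij; [exact: wl|apply/esym; exact: wl].
move=> /andP[_ ui] /andP[ju _].
by have := le_lt_trans (le_trans (cdf_homo x ij) ju) ui; rewrite ltxx.
Qed.

Let cell_ex x u : 0 <= u < 1 -> exists j, cell x j u.
Proof.
case/andP => u0 u1.
have ex : exists j, u < cdf x j.
  apply: contrapT => /forallNP h; move: u1; rewrite ltNge => /negP; apply.
  rewrite -lee_fin -(p1 x); apply: lime_le.
    by apply: is_cvg_nneseries => j _ _; rewrite lee_fin.
  apply: nearW => n /=; rewrite big_mkord sumEFin lee_fin leNgt.
  exact/negP/h.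
case: (ex_minnP ex) => -[|j] uj jmin.
  by move: uj; rewrite /cdf big_ord0 ltNge u0.
exists j; rewrite /cell uj andbT leNgt; apply/negP => /jmin.
by rewrite ltnn.
Qed.

Let idx x u := xget 0%N [set j | cell x j u].

Let idxE x j u : cell x j u -> idx x u = j.
Proof.
move=> ju; rewrite /idx; case: xgetP => [k _ /cell_inj|/(_ j)//]; exact.
Qed.

(** The second component is the randomness left for later steps. *)
Let step (xu : T * R) : T * R :=
  let j := idx xu.1 xu.2 in
  (nx xu.1 j, (xu.2 - cdf xu.1 j) / p xu.1 j).

Let stepE x u j : cell x j u -> step (x, u) = (nx x j, (u - cdf x j) / p x j).
Proof. by move=> ju; rewrite /step/= (idxE ju). Qed.

Let cell_gt0 x j u : cell x j u -> 0 < p x j.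
Proof. by case/andP => ju /(le_lt_trans ju); rewrite cdfS ltrDl. Qed.

Let cell_scale x j u s t : 0 < p x j ->
  (s <= (u - cdf x j) / p x j < t) =
  (cdf x j + p x j * s <= u < cdf x j + p x j * t).
Proof.
by move=> pj; rewrite ler_pdivlMr// ltr_pdivrMr// lerBrDl ltrBlDl !(mulrC (p x j)).
Qed.

Let cellE x j u : 0 < p x j -> cell x j u = (0 <= (u - cdf x j) / p x j < 1).
Proof. by move=> pj; rewrite cell_scale// mulr0 addr0 mulr1 -cdfS. Qed.

Let step_itv x u : 0 <= u < 1 -> 0 <= (step (x, u)).2 < 1.
Proof.
move=> /(cell_ex x)[j ju]; rewrite (stepE ju)/= -cellE//; exact: cell_gt0 ju.
Qed.

Let iter_itv n x u : 0 <= u < 1 -> 0 <= (iter n step (x, u)).2 < 1.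
Proof. move=> u01; elim: n => // n; rewrite iterS [iter n _ _]surjective_pairing.
exact: step_itv.
Qed.

Let cell_itv x j u : cell x j u -> 0 <= u < 1.
Proof.
case/andP => ju uj; rewrite (le_trans _ ju)//=.
exact: lt_le_trans uj _.
Qed.

(** The induction peels off the first step: on the [j]-th cell of [x], the remaining steps start at
    [nx x j] from an affine function of [u], so the set is a countable union of affine preimages. *)
Let measurable_iter n x (B : set T) :
  measurable [set u : R | 0 <= u < 1 /\ B (iter n step (x, u)).1].
Proof.
elim: n x => [|n IH] x.
  have [Bx|Bx] := pselect (B x).
    rewrite (_ : mkset _ = `[0, 1[%classic)//.
    by apply/seteqP; split => u /=; rewrite in_itv/= => // -[].
  by rewrite (_ : mkset _ = set0)//; apply/seteqP; split => u // -[].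
rewrite (_ : mkset _ = \bigcup_j ([set` `[cdf x j, cdf x j.+1[%R] `&`
   ((fun u => (u - cdf x j) / p x j) @^-1`
    [set u : R | 0 <= u < 1 /\ B (iter n step (nx x j, u)).1]))).
  apply: bigcup_measurable => j _; apply: measurableI => //.
  rewrite -[X in measurable X]setTI.
  have mf : measurable_fun setT ((fun u => (u - cdf x j) / p x j) : R -> R).
    by apply: measurable_funM => //; apply: measurable_funB.
  exact: mf.
apply/seteqP; split => u.
  case=> /[dup] u01 /(cell_ex x)[j ju]; rewrite iterSr (stepE ju) => Bu.
  exists j => //; split; first by rewrite /mkset in_itv.
  by split=> //; rewrite -cellE//; exact: cell_gt0 ju.
case=> j _ [ju [_ Bu]]; move: ju; rewrite /mkset in_itv => ju.
by split; [exact: cell_itv ju|rewrite iterSr (stepE ju)].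
Qed.

Local Open Scope ereal_scope.

Let U : probability (measurableTypeR R) R := uniform_prob (@ltr01 R).

Let U_itv (s t : R) : (0 <= s)%R -> (s <= t)%R -> (t <= 1)%R ->
  U [set` `[s, t[%R] = (t - s)%:E.
Proof.
move=> s0 st t1; rewrite /U/= /uniform_prob.
transitivity (\int[lebesgue_measure]_(x in [set` `[s, t[%R]) (cst 1%:E x : \bar R)).
  apply: eq_integral => x; rewrite inE/= in_itv/= => /andP[sx xt].
  by rewrite /uniform_pdf (le_trans s0 sx) (ltW (lt_le_trans xt t1)) subr0 invr1.
rewrite integral_cst//= mul1e lebesgue_measure_itv/= lte_fin.
move: st; rewrite le_eqVlt => /predU1P[->|->//].
by rewrite ltxx subrr.
Qed.

Variable x0 : T.

Let X n u := iter n step (x0, u).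

Let X_step n u j y : (X n u).1 = y -> cell y j (X n u).2 ->
  X n.+1 u = (nx y j, ((X n u).2 - cdf y j) / p y j)%R.
Proof.
by rewrite {3}/X iterS -/(X n u); case: (X n u) => a v /= <-; exact: stepE.
Qed.

Let G n (path : nat -> T) (s t : R) := [set u : R | [/\ (0 <= u < 1)%R,
  forall k, (k <= n)%N -> (X k u).1 = path k & (s <= (X n u).2 < t)%R]].

(** Given the path up to time [n], the remaining number is uniform on [0, 1[. Intervals suffice,
    because cells and their rescaled parts are intervals. *)
Let scales n path := forall s t, (0 <= s)%R -> (s <= t)%R -> (t <= 1)%R ->
  measurable (G n path s t) /\ U (G n path s t) = U (G n path 0 1) * (t - s)%:E.

(** After cell [j], the new remainder lies in [s, t[ exactly when the old one lies in a subinterval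
    of that cell of length [p y j * (t - s)]. Summing over the cells that lead to [path n.+1]
    produces [step_to]. *)
Let G_step n path s t : (0 <= s)%R -> (s <= t)%R -> (t <= 1)%R ->
  scales n path ->
  measurable (G n.+1 path s t) /\
  U (G n.+1 path s t) =
    U (G n path 0 1) * step_to p nx (path n) (path n.+1) * (t - s)%:E.
Proof.
move=> s0 st t1 scn; set y := path n.
pose F j := if `[< nx y j = path n.+1 >]
            then G n path (cdf y j + p y j * s) (cdf y j + p y j * t) else set0.
have GF : G n.+1 path s t = \bigcup_j F j.
  apply/seteqP; split => u.
    case=> u01 upath ust; have un := upath n (leqnSn _).
    have [j ju] := cell_ex y (iter_itv n x0 u01).
    have XS := X_step un ju; move: ust (upath n.+1 (leqnn _)).
    rewrite XS/= cell_scale ?(cell_gt0 ju)// => ust yj.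
    exists j => //; rewrite /F ifT; last exact/asboolP.
    by split=> // k kn; apply: upath; exact: leqW.
  case=> j _; rewrite /F; case: asboolP => // yj [u01 upath ust].
  (* A cell of length 0 would leave an empty interval for the remainder. *)
  have pj : (0 < p y j)%R.
    rewrite lt_neqAle p0 andbT; apply/negP => /eqP pj0.
    by case/andP: ust; rewrite -pj0 !mul0r => /le_lt_trans /[apply]; rewrite ltxx.
  have ju : cell y j (X n u).2.
    rewrite cellE//; move: ust; rewrite -cell_scale// => /andP[su ut].
    by rewrite (le_trans s0 su)/= (lt_le_trans ut t1).
  have XS := X_step (upath n (leqnn _)) ju.
  split=> //; last by rewrite XS/= cell_scale.
  by move=> k; rewrite leq_eqVlt => /predU1P[->|]; [rewrite XS|exact: upath].
have le_p (a : R) j : (a <= 1)%R -> (cdf y j + p y j * a <= 1)%R.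
  move=> a1; apply: le_trans (cdf_le1 y j.+1).
  by rewrite cdfS lerD2l ler_piMr.
have ge_p (a : R) j : (0 <= a)%R -> (0 <= cdf y j + p y j * a)%R.
  by move=> a0; rewrite addr_ge0// mulr_ge0.
have FP j : measurable (F j) /\ U (F j) =
    U (G n path 0 1) * (t - s)%:E * ((p y j)%:E * (`[< nx y j = path n.+1 >]%:R)%:E).
  rewrite /F; case: asboolP => _; last by rewrite measure0 !mule0; split.
  have [] := scn (cdf y j + p y j * s)%R (cdf y j + p y j * t)%R.
  - exact: ge_p.
  - by rewrite lerD2l ler_wpM2l.
  - exact: le_p.
  move=> mG ->; split=> //; rewrite mule1 -muleA -EFinM; congr (_ * _%:E).
  by rewrite opprD addrACA subrr add0r -mulrBr mulrC.
have tF : trivIset setT F.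
  apply/trivIsetP => i j _ _ /eqP ij; apply/seteqP; split => // u; rewrite /F.
  case: asboolP => _; case: asboolP => _; rewrite ?setI0 ?set0I//.
  have sub k : (cdf y k + p y k * s <= (X n u).2 < cdf y k + p y k * t)%R ->
      cell y k (X n u).2.
    case/andP=> ku uk; apply/andP; split.
      by apply: le_trans ku; rewrite lerDl mulr_ge0.
    by apply: lt_le_trans uk _; rewrite cdfS lerD2l ler_piMr.
  by case=> -[_ _ /sub iu] [_ _ /sub ju]; apply: ij; exact: cell_inj iu ju.
rewrite GF; split; first by apply: bigcup_measurable => j _; exact: (FP j).1.
transitivity (\sum_(j <oo) U (F j)).
  apply: measure_semi_bigcup => //; first by move=> j; exact: (FP j).1.
  by apply: bigcup_measurable => j _; exact: (FP j).1.
under eq_eseriesr do rewrite (FP _).2.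
rewrite ge0_nneseriesZl ?mule_ge0 ?lee_fin ?subr_ge0//; last first.
  by move=> j; rewrite mule_ge0 ?lee_fin.
by rewrite -/(step_to p nx y (path n.+1)) -!muleA; congr (_ * _); rewrite muleC.
Qed.

Let G_scales n path : scales n path.
Proof.
elim: n => [|n IH] s t s0 st t1; last first.
  have [mG ->] := G_step s0 st t1 IH.
  have [_ ->] := G_step (lexx 0%R) ler01 (lexx 1%R) IH.
  by rewrite subr0 mule1.
have GE (a c : R) : (0 <= a)%R -> (a <= c)%R -> (c <= 1)%R ->
    G 0 path a c = if `[< x0 = path 0%N >] then [set` `[a, c[%R] else set0.
  move=> a0 ac c1; case: asboolP => xp; apply/seteqP; split => u //=.
  - by case=> _ _; rewrite in_itv.
  - rewrite in_itv/= => /andP[au uc]; split.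
    + by rewrite (le_trans a0 au) (lt_le_trans uc c1).
    + by move=> k; rewrite leqn0 => /eqP ->.
    + by rewrite /X/= au uc.
  - by case=> _ /(_ 0%N (leqnn _)).
rewrite !GE//; case: asboolP => _; last by rewrite measure0 mul0e; split.
split => //; rewrite !U_itv//.
by rewrite subr0 mul1e.
Qed.

Lemma chain_exists : exists d (W : measurableType d) (mu : probability W R)
  (b : nat -> W -> T), chain_law p nx mu b /\ mu [set w | b 0%N w = x0] = 1.
Proof.
(* The cells cover only [0, 1[; off this set, on a [U]-null event, the process stays at [x0]. *)
pose b n u := if (0 <= u < 1)%R then (X n u).1 else x0.
exists _, _, U, b; split; last first.
  rewrite (_ : mkset _ = setT) ?probability_setT//.
  by apply/seteqP; split => u _ //=; rewrite /b; case: ifP.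
have mI : measurable ([set` `[0%R, 1%R[] : set R) by [].
have mb n (B : set T) : measurable (b n @^-1` B).
  have [Bx|Bx] := pselect (B x0).
    rewrite (_ : _ @^-1` _ = [set u : R | (0 <= u < 1)%R /\ B (X n u).1] `|`
      ~` [set` `[0%R, 1%R[]).
      by apply: measurableU; [exact: measurable_iter|exact: measurableC].
    apply/seteqP; split => u /=; rewrite /b in_itv/=; case: ifP => u01.
    - by move=> Bu; left.
    - by move=> _; right.
    - by case=> [[]|].
    - by [].
  rewrite (_ : _ @^-1` _ = [set u : R | (0 <= u < 1)%R /\ B (X n u).1]).
    exact: measurable_iter.
  by apply/seteqP; split => u /=; rewrite /b; case: ifP => // _ [].
split=> // n path.
(* Path events differ from the events [G] only on the null complement of [0, 1[. *)
have pathE m : U [set u | forall k, (k <= m)%N -> b k u = path k] =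
    U (G m path 0 1).
  set A := mkset _.
  have mA : measurable A.
    rewrite (_ : A = \bigcap_(k < m.+1) (b k @^-1` [set path k])).
      by apply: bigcap_measurableType => k _; exact: mb.
    by apply/seteqP; split => w /= h k; apply: h.
  have AI : A `&` [set` `[0%R, 1%R[] = G m path 0 1.
    apply/seteqP; split => u /=; rewrite in_itv/=.
      case=> Au u01; split=> //; last exact: iter_itv.
      by move=> k /Au; rewrite /b u01.
    by case=> u01 h _; split=> // k /h; rewrite /b u01.
  rewrite -AI; apply/eqP; rewrite eq_le; apply/andP; split; last first.
    by apply: le_measure; rewrite ?inE//; exact: measurableI.
  have UC : U (~` [set` `[0%R, 1%R[]) = 0.
    transitivity (1 - U [set` `[0%R, 1%R[]); first exact: probability_setC.
    by rewrite U_itv// subr0 subee.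
  rewrite -[leRHS]adde0 -[X in _ <= _ + X]UC.
  apply: le_trans (measureU2 _ _ _); rewrite ?inE//.
  - apply: le_measure; rewrite ?inE//.
      by apply: measurableU; [exact: measurableI|exact: measurableC].
    by move=> u Au; have [uI|uI] := pselect ([set` `[0%R, 1%R[] u); [left|right].
  - exact: measurableI.
  - exact: measurableC.
rewrite !pathE.
have [_ ->] := G_step (lexx 0%R) ler01 (lexx 1%R) (@G_scales n path).
by rewrite subr0 mule1.
Qed.

End ChainExistence.

(** * Value iteration for belief MDPs *)

Lemma ge0_esumZl (R : realType) (Z : choiceType) (r : R) (f : Z -> \bar R) :
  0 <= r -> (forall z, 0 <= f z)%E ->
  (\esum_(z in [set: Z]) (r%:E * f z) = r%:E * \esum_(z in [set: Z]) f z)%E.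
Proof.
rewrite le_eqVlt => /predU1P[<- f0|r0 f0].
  by rewrite mul0e; apply: esum1 => z _; rewrite mul0e.
rewrite /esum -ereal_sup_pZl//; congr ereal_sup.
have sumZ F : finite_set F ->
    (\sum_(z \in F) (r%:E * f z) = r%:E * \sum_(z \in F) f z)%E.
  by move=> finF; rewrite !fsbig_finite//= ge0_sume_distrr.
apply/seteqP; split => [_ [F [finF FT] <-]|_ [_ [F [finF FT] <-] <-]].
  by exists (\sum_(z \in F) f z)%E; [exists F|rewrite sumZ].
by exists F; rewrite ?sumZ.
Qed.

Lemma dist_ext (R : realType) (X : finType) (b b' : dist R X) :
  (forall x, b x = b' x) -> b = b'.
Proof.
case: b b' => [f fP] [g gP] /= /ffunP fg.
by move: fP; rewrite fg => fP; rewrite (bool_irrelevance fP gP).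
Qed.

Section BeliefValue.
Context (R : realType) (X A : finType) (Z : choiceType).
Variable P : pomdp R X A Z.
Hypothesis T0 : forall x a x', 0 <= po_T P x a x'.
Hypothesis T1 : forall x a, \sum_x' po_T P x a x' = 1.
Hypothesis O0 : forall a x z, 0 <= po_O P a x z.
Hypothesis O1 : forall a x, (\esum_(z in [set: Z]) (po_O P a x z)%:E = 1)%E.
Hypothesis c0 : forall x a, 0 <= po_cost P x a.

Lemma dist_ge0 (b : dist R X) x : 0 <= b x.
Proof. by case/andP: (distP b) => /forallP. Qed.

Lemma dist_sum (b : dist R X) : \sum_x b x = 1.
Proof. by case/andP: (distP b) => _ /eqP. Qed.

Lemma obs_term_ge0 (b : dist R X) a z x :
  0 <= po_O P a x z * \sum_(x' : X) po_T P x' a x * b x'.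
Proof. by rewrite mulr_ge0// sumr_ge0// => x' _; rewrite mulr_ge0// dist_ge0. Qed.

Lemma obs_prob_ge0 (b : dist R X) a z : 0 <= obs_prob P b a z.
Proof. by apply: sumr_ge0 => x _; exact: obs_term_ge0. Qed.

(** Sum out [O] over observations, then [T] over successors, then [b]. *)
Lemma obs_prob_sum (b : dist R X) a :
  (\esum_(z in [set: Z]) (obs_prob P b a z)%:E = 1)%E.
Proof.
under eq_esum do rewrite /obs_prob -sumEFin.
rewrite esum_sum; last by move=> z x _ _; rewrite lee_fin; exact: obs_term_ge0.
transitivity (\sum_x ((\sum_(x' : X) po_T P x' a x * b x')%R)%:E)%E.
  apply: eq_bigr => x _; under eq_esum do rewrite mulrC EFinM.
  rewrite ge0_esumZl ?O1 ?mule1//; last by move=> z; rewrite lee_fin.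
  by rewrite sumr_ge0// => x' _; rewrite mulr_ge0// dist_ge0.
rewrite sumEFin exchange_big/=; congr EFin.
under eq_bigr do rewrite -mulr_suml T1 mul1r.
exact: dist_sum.
Qed.

Lemma next_belief_subproof (b : dist R X) a z : 0 < obs_prob P b a z ->
  let f := [ffun x => belief_update P b a z x] in
  [forall x, 0 <= f x] && (\sum_x f x == 1).
Proof.
move=> bz /=; apply/andP; split.
  apply/forallP => x; rewrite ffunE divr_ge0 ?obs_prob_ge0//.
  exact: obs_term_ge0.
under eq_bigr do rewrite ffunE.
by rewrite -mulr_suml divff// gt_eqF.
Qed.

(* The value [b] for impossible observations is never used. *)
Definition next_belief (b : dist R X) a z : dist R X :=
  if pselect (0 < obs_prob P b a z) is left h
  then Dist (next_belief_subproof h) else b.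

Lemma next_beliefE (b : dist R X) a z x : 0 < obs_prob P b a z ->
  next_belief b a z x = belief_update P b a z x.
Proof. by rewrite /next_belief; case: pselect => //= h _; rewrite ffunE. Qed.

Local Open Scope ereal_scope.

Definition belief_mean (f : dist R X -> \bar R) (b : dist R X) (a : A) : \bar R :=
  \esum_(z in [set: Z]) (obs_prob P b a z)%:E * f (next_belief b a z).

Lemma belief_mean_ge0 f b a : (forall b, 0 <= f b) -> 0 <= belief_mean f b a.
Proof.
by move=> f0; apply: esum_ge0 => z _; rewrite mule_ge0 ?lee_fin ?obs_prob_ge0.
Qed.

Lemma le_belief_mean f g b a : (forall b, f b <= g b) ->
  belief_mean f b a <= belief_mean g b a.
Proof.
by move=> fg; apply: le_esum => z _; rewrite lee_wpmul2l ?lee_fin ?obs_prob_ge0.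
Qed.

(** Bridges the grouping by updated belief and the sum over observations. Impossible observations
    have weight 0, so the default in [next_belief] is harmless. *)
Lemma belief_transE b a b' :
  belief_trans P b a b' = belief_mean (fun y => (`[< y = b' >]%:R)%:E) b a.
Proof.
rewrite /belief_trans esum_mkcond; apply: eq_esum => z _.
case: ifPn; rewrite ?inE ?notin_setE/=.
  case=> bz b'z; rewrite (_ : `[< _ >] = true) ?mule1//.
  by apply/asboolP/dist_ext => x; rewrite next_beliefE ?b'z.
move=> h; have [bz|] := ltP 0%R (obs_prob P b a z).
  rewrite (_ : `[< _ >] = false) ?mule0//.
  by apply/asboolP => nb; apply: h; split => // x; rewrite -nb next_beliefE.
move=> bz; rewrite (_ : obs_prob P b a z = 0%R) ?mul0e//.
by apply/eqP; rewrite eq_le bz obs_prob_ge0.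
Qed.

Lemma belief_cost_ge0 (b : dist R X) a : (0 <= belief_cost P b a)%R.
Proof. by apply: sumr_ge0 => x _; rewrite mulr_ge0 ?dist_ge0. Qed.

Fixpoint policy_cost (pi : policy R X A) (n : nat) (b : dist R X) : \bar R :=
  if n is m.+1
  then (belief_cost P b (pi b))%:E + belief_mean (policy_cost pi m) b (pi b)
  else 0.

Lemma policy_cost_ge0 pi n b : 0 <= policy_cost pi n b.
Proof.
by elim: n b => //= n IH b; rewrite adde_ge0 ?lee_fin ?belief_cost_ge0 ?belief_mean_ge0.
Qed.

Lemma belief_mean_enum b a : exists eq : (nat -> dist R X) * (nat -> R),
  (forall j, (0 <= eq.2 j)%R) /\ forall f, (forall b, 0 <= f b) ->
    belief_mean f b a = \sum_(j <oo) (eq.2 j)%:E * f (eq.1 j).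
Proof.
have [e [q [q0 qe]]] := pmf_enum (obs_prob_ge0 b a) (obs_prob_sum b a).
exists (fun j => next_belief b a (e j), q); split=> // f f0.
exact: (qe (fun z => f (next_belief b a z))).
Qed.

(** Presents the belief MDP under a fixed policy as a countable chain, by choosing an enumeration of
    observations at each belief. *)
Lemma policy_chain (pi : policy R X A) :
  exists (p : dist R X -> nat -> R) (nx : dist R X -> nat -> dist R X),
  [/\ forall b j, (0 <= p b j)%R,
      forall b, \sum_(j <oo) (p b j)%:E = 1 &
      forall f b, (forall b, 0 <= f b) ->
        belief_mean f b (pi b) = step_mean p nx f b].
Proof.
have [eq eqP] := choice (fun b => belief_mean_enum b (pi b)).
exists (fun b => (eq b).2), (fun b => (eq b).1); split.
- by move=> b; exact: (eqP b).1.
- move=> b; rewrite -[RHS](obs_prob_sum b (pi b)).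
  transitivity (belief_mean (fun=> 1) b (pi b)).
    by rewrite (eqP b).2//; apply: eq_eseriesr => j _; rewrite mule1.
  by apply: eq_esum => z _; rewrite mule1.
- by move=> f b f0; rewrite (eqP b).2.
Qed.

(** Each policy has exactly one expected cost: uniqueness comes from [chain_total_cost], existence
    from [chain_exists]. *)
Lemma expected_costP (pi : policy R X A) v :
  expected_cost P pi v <->
  v = ereal_sup (range (fun n => policy_cost pi n (po_b0 P))).
Proof.
have [p [nx [p0 p1 meanE]]] := policy_chain pi.
pose c b := belief_cost P b (pi b).
have c_ge0 b : (0 <= c b)%R by exact: belief_cost_ge0.
have costE n b : policy_cost pi n b = mean_cost p nx c n b.
  elim: n b => //= n IH b; rewrite meanE//; last exact: policy_cost_ge0.
  by congr (_ + _); apply: eq_eseriesr => j _; rewrite IH.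
have transE b b' : belief_trans P b (pi b) b' = step_to p nx b b'.
  by rewrite belief_transE meanE// => y; rewrite lee_fin.
under eq_fun do rewrite costE.
split.
  move=> [d [W [mu [b [[mb init law] ->]]]]].
  rewrite -(chain_total_cost p0 p1 c_ge0 (mu := mu) (b := b))//.
  by split=> // n path; rewrite law transE.
move=> ->; have [d [W [mu [b [[mb law] init]]]]] :=
  chain_exists nx p0 p1 (po_b0 P).
exists d, W, mu, b; split.
  by split=> // n path; rewrite law transE.
by rewrite -(chain_total_cost p0 p1 c_ge0 _ init).
Qed.

Fixpoint optimal_value (n : nat) (b : dist R X) : \bar R :=
  if n is m.+1
  then ereal_inf (range (fun a =>
         (belief_cost P b a)%:E + belief_mean (optimal_value m) b a))
  else 0.

Lemma optimal_value_ge0 n b : 0 <= optimal_value n b.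
Proof.
elim: n b => //= n IH b; apply: le_ereal_inf_tmp => _ [a _ <-].
by rewrite adde_ge0 ?lee_fin ?belief_cost_ge0 ?belief_mean_ge0.
Qed.

Lemma optimal_value_homo m n b : (m <= n)%N ->
  optimal_value m b <= optimal_value n b.
Proof.
elim: m n b => [|m IH] [|n] b //; first by move=> _; exact: optimal_value_ge0.
rewrite ltnS => mn /=; apply: le_ereal_inf_tmp => _ [a _ <-].
apply: ge_ereal_inf; exists ((belief_cost P b a)%:E +
  belief_mean (optimal_value m) b a); first by exists a.
by rewrite leeD2l// le_belief_mean// => b'; exact: IH.
Qed.

Lemma optimal_value_le_policy pi n b : optimal_value n b <= policy_cost pi n b.
Proof.
elim: n b => //= n IH b; apply: ge_ereal_inf.
exists ((belief_cost P b (pi b))%:E + belief_mean (optimal_value n) b (pi b)).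
  by exists (pi b).
by rewrite leeD2l// le_belief_mean.
Qed.

Let limit_value b := ereal_sup (range (optimal_value^~ b)).

(** By monotone convergence for the counting measure, [belief_mean] commutes with the increasing
    limit of the n-stage values; a finite [r] can be moved across the inequality. *)
Lemma belief_mean_limit M b a (r : R) :
  (forall n, r%:E + belief_mean (optimal_value n) b a <= M) ->
  r%:E + belief_mean limit_value b a <= M.
Proof.
move=> leM; have [[e q] /= [q0 qe]] := belief_mean_enum b a.
have V0 n y : 0 <= optimal_value n y := optimal_value_ge0 n y.
have cvgV y : optimal_value n y @[n --> \oo] --> limit_value y.
  by apply: ereal_nondecreasing_cvgn => m n mn; exact: optimal_value_homo.
have L0 y : 0 <= limit_value y.
  by apply: le_trans (V0 0%N y) _; apply: ereal_sup_ubound; exists 0%N.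
have -> : belief_mean limit_value b a =
    limn (fun n => belief_mean (optimal_value n) b a).
  rewrite qe// -[LHS]ge0_integral_count; last by move=> j; rewrite mule_ge0 ?lee_fin.
  transitivity (\int[counting]_j limn (fun n => (q j)%:E * optimal_value n (e j))).
    apply: eq_integral => j _; apply/esym/cvg_lim => //.
    exact: cvgeZl.
  rewrite monotone_convergence//; last 2 first.
  - by move=> n j _; rewrite mule_ge0 ?lee_fin.
  - move=> j _ m n mn; rewrite lee_wpmul2l ?lee_fin//.
    exact: optimal_value_homo.
  congr (limn _); apply/funext => n; rewrite qe// ge0_integral_count// => j.
  by rewrite mule_ge0 ?lee_fin.
have cvgM : cvgn (fun n => belief_mean (optimal_value n) b a).
  apply: ereal_nondecreasing_is_cvgn => m n mn; apply: le_belief_mean => y.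
  exact: optimal_value_homo.
rewrite -leeBrDl//; apply: lime_le => //; apply: nearW => n.
by rewrite leeBrDl.
Qed.

(* If every action lost more than [limit_value b] from some horizon on, so
   would all of them at a common horizon, there being finitely many actions. *)
Lemma greedy_action (a0 : A) b : exists a,
  (belief_cost P b a)%:E + belief_mean limit_value b a <= limit_value b.
Proof.
pose f n a := (belief_cost P b a)%:E + belief_mean (optimal_value n) b a.
suff [a leV] : exists a, forall n, f n a <= limit_value b.
  by exists a; exact: belief_mean_limit.
apply: contrapT => /forallNP h.
have /choice[n ltV] : forall a, exists n, limit_value b < f n a.
  by move=> a; have /existsNP[n /negP] := h a; rewrite -ltNge => ?; exists n.
pose N := \max_a n a.
(* The infimum defining [optimal_value N.+1 b] is attained at [a], so the strict inequality survives
   it. *)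
have [a _ a_min] := @Order.TotalTheory.arg_minP _ _ _ a0 xpredT (f N) isT.
have : limit_value b < optimal_value N.+1 b.
  apply: (@lt_le_trans _ _ (f N a)).
    apply: lt_le_trans (ltV a) _; rewrite leeD2l// le_belief_mean// => y.
    by apply: optimal_value_homo; exact: leq_bigmax.
  by apply: le_ereal_inf_tmp => _ [a' _ <-]; exact: a_min.
rewrite ltNge => /negP; apply; apply: ereal_sup_ubound.
by exists N.+1.
Qed.

Lemma optimal_costE (a0 : A) : optimal_cost P =
  ereal_sup (range (fun n => optimal_value n (po_b0 P))).
Proof.
apply/eqP; rewrite eq_le; apply/andP; split; last first.
  apply: le_ereal_inf_tmp => v [pi /expected_costP ->].
  apply: ge_ereal_sup => _ [n _ <-]; apply: le_ereal_sup_tmp.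
  by exists (policy_cost pi n (po_b0 P)); [exists n|exact: optimal_value_le_policy].
have [pi greedy] := choice (greedy_action a0).
apply: ge_ereal_inf; exists (ereal_sup (range (fun n => policy_cost pi n (po_b0 P)))).
  by exists pi; apply/expected_costP.
apply: ge_ereal_sup => _ [n _ <-]; rewrite -/(limit_value (po_b0 P)).
(* The bound is proved at every belief: one greedy step costs no more than the limit value, and the
   induction hypothesis bounds what follows. *)
elim: n (po_b0 P) => [|n IH] b /=.
  by apply: le_trans (optimal_value_ge0 0 b) _; apply: ereal_sup_ubound; exists 0%N.
by apply: le_trans (greedy b); rewrite leeD2l// le_belief_mean.
Qed.

End BeliefValue.

(** * Bisimulation of Goal POMDPs *)

Lemma sum_pair (R : realType) (S Q : finType) (f : S * Q -> R) :
  \sum_x f x = \sum_s \sum_q f (s, q).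
Proof. by rewrite pair_bigA/=; apply: eq_bigr => -[]. Qed.

Section GoalPomdpModel.
Context (R : realType) (S E Q : finType) (Y : choiceType).
Variables (M : event_model R S E) (B : obs_model R S Y) (D : dfa E Q).
Local Notation P := (goal_pomdp M B D).
Local Notation F := (dfa_acc D).

Definition goal_next (q : Q) (e : E) (s : S) : Q :=
  if (q \notin F) && (e \in em_ev M s) then dfa_delta D q e else q.

(** The [S]-part of a transition depends on the automaton state only through acceptance, hence the
    boolean argument, which can be shared by both automata. *)
Definition goal_kernel (fin : bool) (s s' : S) : R :=
  if fin then (s' == s)%:R else em_P M s s'.

Lemma goal_TE s q e s' q' : po_T P (s, q) e (s', q') =
  if q' == goal_next q e s' then goal_kernel (q \in F) s s' else 0.
Proof.
rewrite /= /goal_next /goal_kernel; case: (q \in F) => /=.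
  by case: (q' == q).
by case: (e \in em_ev M s') => /=; rewrite ?andbT ?andbF ?orbF.
Qed.

Lemma goal_kernel_ge0 fin s s' : 0 <= goal_kernel fin s s'.
Proof. by rewrite /goal_kernel; case: fin => //; case/andP: (em_P01 M s s'). Qed.

Lemma goal_T_ge0 x e x' : 0 <= po_T P x e x'.
Proof.
case: x x' => s q [s' q']; rewrite goal_TE; case: ifP => // _.
exact: goal_kernel_ge0.
Qed.

Lemma goal_T_sum x e : \sum_x' po_T P x e x' = 1.
Proof.
case: x => s q; transitivity (\sum_s' goal_kernel (q \in F) s s').
  rewrite sum_pair; apply: eq_bigr => s' _; under eq_bigr do rewrite goal_TE.
  by rewrite -big_mkcond big_pred1_eq.
rewrite /goal_kernel; case: (q \in F); last exact: em_P_sum.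
by rewrite (bigD1 s)//= eqxx big1 ?addr0// => s' /negbTE ->.
Qed.

Lemma goal_O_ge0 e x z : 0 <= po_O P e x z.
Proof.
case: x => s q /=; case: ifP => _; first by case: z.
case: z => // -[b y]; case: ifP => // _.
by case/andP: (om_h01 B s y).
Qed.

Lemma goal_O_sum e x :
  (\esum_(z in [set: option (bool * Y)]) (po_O P e x z)%:E = 1)%E.
Proof.
case: x => s q /=; case: (q \in F).
  transitivity (\esum_(z in [set (None : option (bool * Y))]) (1 : \bar R))%E.
    rewrite [RHS]esum_mkcond; apply: eq_esum => -[z|] _.
      by rewrite ifF//; apply/negP; rewrite inE.
    by rewrite ifT// inE.
  by rewrite esum_set1.
rewrite -(om_h_sum B s).
(* Outside [F] the bit is determined by [s], so all mass sits on the image of [i]. *)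
pose i (y : Y) := Some (e \in em_ev M s, y).
transitivity (\esum_(z in i @` [set: Y])
    (if z is Some (_, y) then (om_h B s y)%:E else 0))%E; last first.
  by rewrite esum_image// => y y' _ _ [].
rewrite [RHS]esum_mkcond; apply: eq_esum => -[[b y]|] _; last by rewrite if_same.
case: eqP => [->|nb]; case: ifPn; rewrite ?inE ?notin_setE//=.
  by case; exists y.
by case=> y' _ [/esym].
Qed.

Lemma goal_cost_ge0 x e : 0 <= po_cost P x e.
Proof. by []. Qed.

(* The automaton state after observing [z], which tells whether the transition
   was taken: [None] outside [F] means that it was, and led into [F]. *)
Definition obs_next (q : Q) (e : E) (z : option (bool * Y)) : Q :=
  if (q \in F) || (if z is Some (false, _) then true else false) then q
  else dfa_delta D q e.

(** For [q] outside [F], the bit False is impossible when [e] occurs at [s], while True and bottom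
    are impossible when it does not. The observation thus reveals the automaton state without [s]
    being known. *)
Lemma obs_nextE q e s z : po_O P e (s, goal_next q e s) z != 0 ->
  obs_next q e z = goal_next q e s.
Proof.
rewrite /obs_next /goal_next /=; case qF : (q \in F) => //=.
case es : (e \in em_ev M s) => /=; case: z => [[[] y]|]//=.
- by case: ifP; rewrite eqxx.
- by rewrite qF eqxx.
- by rewrite qF eqxx.
Qed.

(** * Beliefs concentrated on one automaton state *)

Section Concentrated.
Variables (q : Q) (b : dist R (S * Q)%type).
Hypothesis bq : forall s p, p != q -> b (s, p) = 0.

Lemma sum_concentrated (f : S * Q -> R) :
  \sum_x f x * b x = \sum_s f (s, q) * b (s, q).
Proof.
rewrite sum_pair; apply: eq_bigr => s _.
by rewrite (bigD1 q)//= big1 ?addr0// => p pq; rewrite bq ?mulr0.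
Qed.

Lemma sum_T_concentrated e s' p : \sum_x po_T P x e (s', p) * b x =
  if p == goal_next q e s'
  then \sum_s goal_kernel (q \in F) s s' * b (s, q) else 0.
Proof.
rewrite sum_concentrated; under eq_bigr do rewrite goal_TE.
by case: ifP => // _; rewrite big1// => s _; rewrite mul0r.
Qed.

Lemma belief_cost_concentrated e : belief_cost P b e =
  (q \notin F)%:R * \sum_s b (s, q).
Proof.
rewrite /belief_cost; under eq_bigr do rewrite mulrC.
rewrite sum_concentrated mulr_sumr; apply: eq_bigr => s _ /=.
by rewrite /goal_cost inE.
Qed.

Lemma obs_prob_concentrated e z : obs_prob P b e z =
  \sum_s' po_O P e (s', goal_next q e s') z *
          \sum_s goal_kernel (q \in F) s s' * b (s, q).
Proof.
rewrite /obs_prob sum_pair; apply: eq_bigr => s' _.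
under eq_bigr do rewrite sum_T_concentrated.
set t := \sum_s goal_kernel _ s s' * b (s, q).
rewrite (bigD1 (goal_next q e s'))// eqxx big1; first exact: addr0.
by move=> p /andP[_ /negbTE ->]; rewrite mulr0.
Qed.

Lemma belief_update_concentrated e z s p : p != obs_next q e z ->
  belief_update P b e z (s, p) = 0.
Proof.
move=> pq; rewrite /belief_update sum_T_concentrated.
case: eqP => [ps|_]; last by rewrite mulr0 mul0r.
have [->|] := eqVneq (po_O P e (s, p) z) 0; first by rewrite !mul0r.
by rewrite ps => /obs_nextE qz; rewrite ps qz eqxx in pq.
Qed.

(** On the right the automaton state depends on [s], on the left only on [z]; where they differ,
    [obs_nextE] makes the observation impossible and both sides vanish. *)
Lemma belief_update_obs_next e z s :
  belief_update P b e z (s, obs_next q e z) =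
  po_O P e (s, goal_next q e s) z *
  (\sum_s' goal_kernel (q \in F) s' s * b (s', q)) / obs_prob P b e z.
Proof.
rewrite /belief_update sum_T_concentrated.
case: eqP => [->//|qz]; rewrite mulr0 mul0r.
have [->|/obs_nextE //] := eqVneq (po_O P e (s, goal_next q e s) z) 0.
by rewrite !mul0r.
Qed.

End Concentrated.
End GoalPomdpModel.

Section Bisimulation.
Context (R : realType) (S E Q Q' : finType) (Y : choiceType).
Variables (M : event_model R S E) (B : obs_model R S Y).
Variables (D : dfa E Q) (D' : dfa E Q').
Local Notation P := (goal_pomdp M B D).
Local Notation P' := (goal_pomdp M B D').

(** Nerode equivalence, between states of two automata. *)
Definition same_residual (q : Q) (q' : Q') := forall w,
  (foldl (dfa_delta D) q w \in dfa_acc D) =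
  (foldl (dfa_delta D') q' w \in dfa_acc D').

Definition bisimilar (b : dist R (S * Q)%type) (b' : dist R (S * Q')%type) :=
  exists q q', [/\ same_residual q q',
    forall s p, p != q -> b (s, p) = 0,
    forall s p, p != q' -> b' (s, p) = 0 &
    forall s, b (s, q) = b' (s, q')].

Lemma same_residual_acc q q' : same_residual q q' ->
  (q \in dfa_acc D) = (q' \in dfa_acc D').
Proof. by move/(_ [::]). Qed.

Lemma same_residual_delta q q' e : same_residual q q' ->
  same_residual (dfa_delta D q e) (dfa_delta D' q' e).
Proof. by move=> qq' w; exact: (qq' (e :: w)). Qed.

Lemma same_residual_goal_next q q' e s : same_residual q q' ->
  same_residual (goal_next M D q e s) (goal_next M D' q' e s).
Proof.
move=> qq'; rewrite /goal_next (same_residual_acc qq').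
by case: ifP => _ //; exact: same_residual_delta.
Qed.

Lemma same_residual_obs_next q q' e (z : option (bool * Y)) :
  same_residual q q' -> same_residual (obs_next D q e z) (obs_next D' q' e z).
Proof.
move=> qq'; rewrite /obs_next (same_residual_acc qq').
by case: ifP => _ //; exact: same_residual_delta.
Qed.

Lemma same_residual_goal_O q q' e s z : same_residual q q' ->
  po_O P e (s, q) z = po_O P' e (s, q') z.
Proof. by move=> qq' /=; rewrite (same_residual_acc qq'). Qed.

Lemma bisimilar_cost b b' e : bisimilar b b' ->
  belief_cost P b e = belief_cost P' b' e.
Proof.
case=> q [q' [qq' bq bq' bb']].
rewrite (belief_cost_concentrated _ _ _ bq) (belief_cost_concentrated _ _ _ bq').
by rewrite (same_residual_acc qq'); congr (_ * _); apply: eq_bigr.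
Qed.

Lemma bisimilar_obs_prob b b' e z : bisimilar b b' ->
  obs_prob P b e z = obs_prob P' b' e z.
Proof.
case=> q [q' [qq' bq bq' bb']].
rewrite (obs_prob_concentrated _ _ _ bq) (obs_prob_concentrated _ _ _ bq').
rewrite (same_residual_acc qq'); apply: eq_bigr => s _.
rewrite (same_residual_goal_O _ _ _ (same_residual_goal_next e s qq')).
by congr (_ * _); apply: eq_bigr => s' _; rewrite bb'.
Qed.

(** Stated through pointwise values of [c] and [c'], to stay clear of the positivity proofs inside
    [next_belief]. *)
Lemma bisimilar_next b b' e z (c : dist R (S * Q)%type) (c' : dist R (S * Q')%type) :
  bisimilar b b' ->
  (forall x, c x = belief_update P b e z x) ->
  (forall x, c' x = belief_update P' b' e z x) -> bisimilar c c'.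
Proof.
move=> bb cE c'E; have pbb := bisimilar_obs_prob e z bb.
case: bb => q [q' [qq' bq bq' bb']].
exists (obs_next D q e z), (obs_next D' q' e z); split.
- exact: same_residual_obs_next.
- by move=> s p; rewrite cE => /(belief_update_concentrated _ _ bq).
- by move=> s p; rewrite c'E => /(belief_update_concentrated _ _ bq').
move=> s; rewrite cE c'E (belief_update_obs_next _ _ _ bq).
rewrite (belief_update_obs_next _ _ _ bq') pbb (same_residual_acc qq').
rewrite (same_residual_goal_O _ _ _ (same_residual_goal_next e s qq')).
by congr (_ * _ / _); apply: eq_bigr => s' _; rewrite bb'.
Qed.

Let value := optimal_value (goal_T_ge0 M B D) (goal_O_ge0 M B D).
Let value' := optimal_value (goal_T_ge0 M B D') (goal_O_ge0 M B D').

Lemma bisimilar_value n b b' : bisimilar b b' -> value n b = value' n b'.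
Proof.
elim: n b b' => // n IH b b' bb; rewrite /value /value' /=.
apply: (congr1 (fun f => ereal_inf (range f))).
apply/funext => e; rewrite (bisimilar_cost e bb); congr (_ + _)%E.
apply: eq_esum => z _.
have pbb := bisimilar_obs_prob e z bb; rewrite -pbb.
(* Only possible observations need bisimilar updates; the others contribute 0. *)
have [bz|] := ltP 0 (obs_prob P b e z).
  congr (_ * _)%E; apply: IH.
  by apply: (bisimilar_next (z := z) (e := e) bb) => x;
    rewrite next_beliefE// -pbb.
move=> bz; suff -> : obs_prob P b e z = 0 by rewrite !mul0e.
apply/eqP; rewrite eq_le bz; apply: obs_prob_ge0; first exact: goal_T_ge0.
exact: goal_O_ge0.
Qed.

End Bisimulation.

Theorem theorem1 (R : realType) (S E : finType) (Y : choiceType)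
    (M : event_model R S E) (B : obs_model R S Y)
    (Q Q' : finType) (D : dfa E Q) (D' : dfa E Q')
    (hL : dfa_lang D = dfa_lang D') :
  optimal_cost (goal_pomdp M B D) = optimal_cost (goal_pomdp M B D').
Proof.
(* With no events there are no policies, so both infima range over the empty set. *)
have [e _|noE] := pickP (@predT E); last first.
  rewrite /optimal_cost; congr ereal_inf; apply/seteqP; split => v [pi _].
    by have := noE (pi (po_b0 (goal_pomdp M B D))).
  by have := noE (pi (po_b0 (goal_pomdp M B D'))).
have costE Q0 (D0 : dfa E Q0) := optimal_costE (goal_T_ge0 M B D0)
  (goal_T_sum M B D0) (goal_O_ge0 M B D0) (goal_O_sum M B D0)
  (goal_cost_ge0 M B D0) e.
rewrite !costE; apply: (congr1 (fun f => ereal_sup (range f))); apply/funext => n.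
apply: bisimilar_value; exists (dfa_init D), (dfa_init D'); split.
(* Equality of the languages is the equality of residuals at the initial states. *)
- by move=> w; apply/idP/idP; have := congr1 (fun L => L w) hL;
    rewrite /dfa_lang/mkset => ->.
- by move=> s p /negbTE pq; rewrite /= ffunE xpair_eqE pq andbF.
- by move=> s p /negbTE pq; rewrite /= ffunE xpair_eqE pq andbF.
- by move=> s; rewrite /= !ffunE !xpair_eqE !eqxx.
Qed.
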